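(* Let $(G_N)_{N\in\mathbb N}$ be an increasing sequence of compact groups of $*$-automorphisms of a $C^*$-algebra $\mathcal A$, let $G=\bigcup_N G_N$, and let $\varphi$ be a faithful $G$-strongly quasi-invariant state on $\mathcal A$, with GNS representation $(\mathcal H,\pi,\Phi)$ and $\mathfrak A=\pi(\mathcal A)''$. Let $P_N=\int_{G_N}U_g\,dg$, $P_G=\text{s-}\lim_N P_N$, and $\Phi_G=P_G\Phi$. Suppose that $\Phi_G\neq 0$. Then the state $\psi_G(\cdot)=\|\Phi_G\|^{-2}\langle\Phi_G,\,\cdot\,\Phi_G\rangle$ on $\mathfrak A$ is $\hat G$-invariant, i.e. $\psi_G(u_g(x))=\psi_G(x)$ for all $g\in G$, $x\in\mathfrak A$.
   Context: A faithful state $\varphi$ on $\mathcal A$ is $G$-strongly quasi-invariant if for every $g\in G$ there is a self-adjoint $x_g\in\mathcal A$ with $\varphi(g(a))=\varphi(x_g a)$ for all $a\in\mathcal A$. (It is known that then each $x_g$ is strictly positive, lies in the centralizer of $\varphi$, and the $x_g$ commute with each other.) The formula $U_g\pi(a)\Phi=\pi(g(a)x_{g^{-1}}^{1/2})\Phi$ $(a\in\mathcal A)$ defines a unitary representation $g\mapsto U_g$ of $G$ on $\mathcal H$. On $\mathfrak A$ put $u_g(x)=U_g x U_g^*$ and $\hat G=\{u_g:g\in G\}$; the $u_g$ are $*$-automorphisms of $\mathfrak A$ with $u_g(\pi(a))=\pi(g(a))$. Standing assumptions: on each $G_N$ the map $g\mapsto x_g\in\mathcal A$ is continuous and $g\mapsto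 U_g$ is strongly continuous. Integrals over $G_N$ are with respect to normalized Haar measure. The $P_N$ form a decreasing sequence of orthogonal projections, so the strong limit $P_G$ exists. *)

(* Defs.v *)
From HB Require Import structures.
From mathcomp Require Import all_boot all_order all_algebra.
From mathcomp Require Import sesquilinear complex.
From mathcomp Require Import all_classical all_reals all_analysis.

Set Implicit Arguments.
Unset Strict Implicit.
Unset Printing Implicit Defensive.

Import Order.TTheory GRing.Theory Num.Theory.
Import numFieldNormedType.Exports.

Local Open Scope classical_set_scope.
Local Open Scope ring_scope.

(* No unit is required, so the product cannot be a MathComp ring product. *)
HB.mixin Record isCStarAlgebra (R : realType) A
    & CompleteNormedModule R[i] A := {
  cmul : A -> A -> A;
  star : A -> A;
  cmulA : associative cmul;
  cmulDl : left_distributive cmul +%R;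
  cmulDr : right_distributive cmul +%R;
  cmulZl : forall (c : R[i]) (a b : A), cmul (c *: a) b = c *: cmul a b;
  cmulZr : forall (c : R[i]) (a b : A), cmul a (c *: b) = c *: cmul a b;
  starK : involutive star;
  starD : {morph star : a b / a + b};
  starZ : forall (c : R[i]) (a : A), star (c *: a) = c^* *: star a;
  starM : forall a b : A, star (cmul a b) = cmul (star b) (star a);
  normM_le : forall a b : A, `|cmul a b| <= `|a| * `|b|;
  cstar_norm : forall a : A, `|cmul (star a) a| = `|a| ^+ 2
}.

#[short(type="cstarAlgType")]
HB.structure Definition CStarAlgebra (R : realType) :=
  {A of isCStarAlgebra R A & CompleteNormedModule R[i] A}.

(* As for every MathComp form, inner is linear in its FIRST argument: a product
   <v, w> that is linear in w is written inner w v. *)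
HB.mixin Record isHilbert (R : realType) H
    & CompleteNormedModule R[i] H := {
  inner : {dot H for @Num.conj R[i]};
  norm_inner : forall v : H, `|v| ^+ 2 = inner v v
}.

#[short(type="hilbertType")]
HB.structure Definition Hilbert (R : realType) :=
  {H of isHilbert R H & CompleteNormedModule R[i] H}.

HB.mixin Record isTopologicalGroup G & PointedTopological G & Group G := {
  mulg_continuous : continuous (fun p : G * G => (p.1 * p.2)%g);
  invg_continuous : continuous (fun k : G => k^-1%g)
}.

#[short(type="topGroupType")]
HB.structure Definition TopologicalGroup :=
  {G of isTopologicalGroup G & PointedTopological G & Group G}.

Section StarAutomorphisms.
Variables (R : realType) (A : cstarAlgType R).

Record starAut := StarAut {
  aut_fun :> A -> A;
  aut_inv : A -> A;
  aut_funK : cancel aut_fun aut_inv;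
  aut_invK : cancel aut_inv aut_fun;
  aut_linear : linear aut_fun;
  aut_cmul : {morph aut_fun : a b / cmul a b};
  aut_star : {morph aut_fun : a / star a}
}.

Lemma starAutP (g h : starAut) : aut_fun g =1 aut_fun h -> g = h.
Proof.
case: g h => [f f' fK f'K fl fm fs] [k k' kK k'K kl km ks] /= /funext fk.
rewrite -{}fk in kK k'K kl km ks *.
have f'k' : f' = k' by apply/funext => a; rewrite -{1}(k'K a) fK.
rewrite -{}f'k' in kK k'K *.
by congr StarAut; exact: Prop_irrelevance.
Qed.

HB.instance Definition _ := gen_eqMixin starAut.
HB.instance Definition _ := gen_choiceMixin starAut.

Definition aut1 : starAut.
Proof. by exists id id. Defined.

Definition autV (g : starAut) : starAut.
Proof.
exists (aut_inv g) g; [exact: aut_invK|exact: aut_funK| | | ].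
- move=> c a b; apply: (can_inj (aut_funK g)).
  by rewrite aut_linear !aut_invK.
- move=> a b; apply: (can_inj (aut_funK g)).
  by rewrite aut_cmul !aut_invK.
- by move=> a; apply: (can_inj (aut_funK g)); rewrite aut_star !aut_invK.
Defined.

Definition autM (g h : starAut) : starAut.
Proof.
exists (g \o h) (aut_inv h \o aut_inv g).
- by move=> a /=; rewrite !aut_funK.
- by move=> a /=; rewrite !aut_invK.
- by move=> c a b /=; rewrite !aut_linear.
- by move=> a b /=; rewrite !aut_cmul.
- by move=> a /=; rewrite !aut_star.
Defined.

Lemma autMA : associative autM. Proof. by move=> *; exact: starAutP. Qed.
Lemma aut1M : left_id aut1 autM. Proof. by move=> *; exact: starAutP. Qed.
Lemma autM1 : right_id aut1 autM. Proof. by move=> *; exact: starAutP. Qed.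
Lemma autVM : left_inverse aut1 autV autM.
Proof. by move=> g; apply: starAutP => a /=; rewrite aut_funK. Qed.
Lemma autMV : right_inverse aut1 autV autM.
Proof. by move=> g; apply: starAutP => a /=; rewrite aut_invK. Qed.

HB.instance Definition _ :=
  isGroup.Build starAut autMA aut1M autM1 autVM autMV.

End StarAutomorphisms.

Section States.
Variables (R : realType) (A : cstarAlgType R).
Implicit Types (phi : A -> R[i]) (x : A) (g : starAut A) (G : set (starAut A)).

Definition functional_norm phi : \bar R :=
  ereal_sup [set (complex.Re `|phi a|)%:E | a in [set a : A | `|a| <= 1]].

Definition is_state phi :=
  [/\ scalar phi, forall a, 0 <= phi (cmul (star a) a)
    & functional_norm phi = 1%:E].

Definition is_faithful phi := forall a, phi (cmul (star a) a) = 0 -> a = 0.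

Definition cpositive x := exists b : A, x = cmul (star b) b.

(* The junk value 0 is only taken when x is not positive. *)
Definition csqrt x : A := xget 0 [set y | cpositive y /\ cmul y y = x].

Definition rn_spec phi g x :=
  star x = x /\ forall a, phi (g a) = phi (cmul x a).

Definition strongly_quasi_invariant G phi :=
  forall g, G g -> exists x, rn_spec phi g x.

(* The element x_g; it is unique when phi is a faithful state. *)
Definition rn phi g : A := xget 0 [set x | rn_spec phi g x].

End States.

Section Operators.
Variables (R : realType) (H : hilbertType R).
Implicit Types (T S : H -> H) (M : set (H -> H)).

Definition bounded_op T := linear T /\ continuous T.

Definition unitary_op T :=
  [/\ linear T, forall v w, inner (T v) (T w) = inner v w
    & forall w, exists v, T v = w].

(* Every bounded operator has a unique adjoint, so the default is never taken
   for such operators. *)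
Definition adjoint T : H -> H :=
  xget (fun=> 0) [set S | forall v w, inner (S v) w = inner v (T w)].

Definition commutant M : set (H -> H) :=
  [set T | bounded_op T /\ forall S, M S -> T \o S = S \o T].

Definition bicommutant M : set (H -> H) := commutant (commutant M).

Definition is_operator_state M (psi : (H -> H) -> R[i]) :=
  [/\ forall (c : R[i]) S T, M S -> M T ->
        psi (fun v => c *: S v + T v) = c * psi S + psi T,
      forall T, M T -> (forall v, 0 <= inner (T v) v) -> 0 <= psi T
    & psi id = 1].

Definition vector_state (xi : H) (T : H -> H) : R[i] :=
  `|xi| ^- 2 * inner (T xi) xi.

End Operators.

Section Representations.
Variables (R : realType) (A : cstarAlgType R) (H : hilbertType R).
Implicit Types (phi : A -> R[i]) (pi : A -> H -> H) (Phi : H).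
Implicit Types (G : set (starAut A)) (U : starAut A -> H -> H).

Record is_gns phi pi Phi : Prop := IsGNS {
  gns_bounded : forall a, bounded_op (pi a);
  gns_linear : forall (c : R[i]) a b v,
    pi (c *: a + b) v = c *: pi a v + pi b v;
  gns_mul : forall a b v, pi (cmul a b) v = pi a (pi b v);
  gns_star : forall a v w, inner (pi a v) w = inner v (pi (star a) w);
  gns_cyclic : closure [set pi a Phi | a in [set: A]] = [set: H];
  gns_state : forall a, phi a = inner (pi a Phi) Phi
}.

Record is_unitary_rep G U : Prop := IsUnitaryRep {
  rep_unitary : forall g, G g -> unitary_op (U g);
  rep_mul : forall g h, G g -> G h -> U (g * h)%g = U g \o U h
}.

Definition quasi_koopman phi pi Phi G U :=
  forall g a, G g ->
    U g (pi a Phi) = pi (cmul (g a) (csqrt (rn phi g^-1%g))) Phi.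

Definition conj_by U (g : starAut A) (x : H -> H) : H -> H :=
  U g \o x \o adjoint (U g).

End Representations.

Definition borel (K : ptopologicalType) := g_sigma_algebraType (@open K).

Section Haar.
Variables (R : realType) (K : topGroupType) (mu : probability (borel K) R).

Definition is_haar :=
  [/\ forall (k : K) (B : set (borel K)), measurable B ->
        mu [set (k * h)%g | h in (B : set K)] = mu B,
      forall B : set (borel K), measurable B ->
        mu B = ereal_inf
          [set mu V | V in [set V : set K | open V /\ B `<=` V]]
    & forall V : set K, open V ->
        mu V = ereal_sup
          [set mu C | C in [set C : set K | compact C /\ C `<=` V]]].

Definition cintegral (f : K -> R[i]) : R[i] :=
  ((\int[mu]_k complex.Re (f k)) +i* (\int[mu]_k complex.Im (f k)))%C.

(* P is the operator integral of V, taken in the weak sense; for a strongly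
   continuous family on a compact group this agrees with the strong one. *)
Definition is_operator_integral (H : hilbertType R) (V : K -> H -> H)
    (P : H -> H) :=
  forall v w, inner (P v) w = cintegral (fun k => inner (V k v) w).

End Haar.

(* Main.v *)
Require Import Defs.
From HB Require Import structures.
From mathcomp Require Import all_boot all_order all_algebra.
From mathcomp Require Import sesquilinear complex.
From mathcomp Require Import all_classical all_reals all_analysis.
From mathcomp Require Import measurable_realfun ring.

Set Implicit Arguments.
Unset Strict Implicit.
Unset Printing Implicit Defensive.

Import Order.TTheory GRing.Theory Num.Theory.
Import numFieldNormedType.Exports.

Local Open Scope classical_set_scope.
Local Open Scope ring_scope.

(** An average over a group is fixed by the group: left invariance of Haar
measure gives [U_h P_N = P_N] for [h] in [G_N].  An element [g] of [G] lies in
every [G_N] from some rank on, so it fixes [P_N Phi] for all large [N], hence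
also the limit [Phi_G].  A vector fixed by the unitary [U_g] is fixed by
[U_g^*] too, and therefore [<U_g x U_g^* Phi_G, Phi_G> = <x Phi_G, Phi_G>] for
every operator [x].

The operator integrals are weak, so the first step is an identity between
scalar integrals of matrix coefficients: for [w = U_h w'],
[<U_h P_N v, w> = <P_N v, w'> = \int <U_k v, w'> dk = \int <U_(hk) v, w> dk],
and the last integral is [<P_N v, w>] by invariance
([haar_cintegral_mulg], [operator_integral_fixed]).  Continuity of the matrix
coefficients makes them Borel; it rests on continuity of the inner product,
obtained here from the polarization identity.  Strong convergence is likewise
used only through matrix coefficients when passing to the limit
([unitary_limit_fixed]), and [vector_state_conj_by] turns the invariance of
[Phi_G] into that of its vector state. *)

Local Notation cplx R := (R[i] : numFieldType).

(** * Continuity of the inner product *)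

Lemma continuous_Re (R : realType) :
  continuous (fun z : cplx R => complex.Re z).
Proof.
move=> z; apply/(@cvgrPdist_lt _ R _ _ (nbhs_filter z)) => e e0.
have e0' : 0 < (e%:C)%C by rewrite ltcR.
near=> t; rewrite -ltcR.
have -> : complex.Re z - complex.Re t = complex.Re (z - t).
  by case: (z) (t) => a b [c d].
apply: le_lt_trans (normc_ge_Re _) _.
near: t; exact: (@cvgr_dist_lt _ _ _ _ _ id z).
Unshelve. all: by end_near. Qed.

Lemma Im_eq_Re (R : realType) (z : R[i]) :
  complex.Im z = complex.Re (- 'i%C * z).
Proof. by case: z => a b; simpc. Qed.

(** Expressing the form through norms alone lets its continuity follow from
that of the norm; the second group of terms, with [w] rotated by [i], recovers
the imaginary part. *)
Lemma polarization (R : realType) (H : hilbertType R) (v w : H) :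
  inner v w = 2%:R^-1 * ((`|v + w| ^+ 2 - `|v| ^+ 2 - `|w| ^+ 2)
    + 'i%C * (`|v + 'i%C *: w| ^+ 2 - `|v| ^+ 2 - `|'i%C *: w| ^+ 2)).
Proof.
have E (u1 u2 : H) : `|u1 + u2| ^+ 2 - `|u1| ^+ 2 - `|u2| ^+ 2 =
    inner u1 u2 + (inner u1 u2)^*.
  by rewrite !norm_inner dnormD -addrA -opprD addrAC subrr add0r.
rewrite !E linearZr_LR /=.
apply: (mulfI (x := 2%:R)); first by rewrite pnatr_eq0.
rewrite mulVKf ?pnatr_eq0 //.
case: (inner v w) => a b; simpc; rewrite /=.
apply/eqP; rewrite eq_complex /=; apply/andP; split; apply/eqP; ring.
Qed.

Lemma continuous_innerl (R : realType) (H : hilbertType R) (w : H) :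
  continuous (fun v : H => inner v w : cplx R).
Proof.
have N (u : H) : continuous (fun x : H => `|x + u| ^+ 2 : cplx R).
  move=> v; rewrite /continuous_at expr2; under eq_fun do rewrite expr2.
  by apply: cvgM; apply: cvg_norm; apply: cvgD;
    by [exact: cvg_id|exact: cvg_cst].
have N0 : continuous (fun x : H => `|x| ^+ 2 : cplx R).
  move=> v; have := N 0 v; rewrite /continuous_at addr0.
  by under eq_fun do rewrite addr0.
move=> v; rewrite /continuous_at polarization.
under eq_fun do rewrite polarization.
apply: cvgMl_tmp; apply: cvgD; last apply: cvgMl_tmp.
all: apply: cvgB; [apply: cvgB; [exact: N|exact: N0]|exact: cvg_cst].
Qed.

(** * Left invariance of Haar integrals *)

Lemma continuous_borel_measurable (R : realType) (K : topGroupType)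
    (f : K -> R) :
  continuous f -> measurable_fun [set: borel K] (f : borel K -> R).
Proof.
move=> /continuousP fc; apply: (measurability _ (RGenOpens.measurableE R)).
move=> _ [_ [a [b ->] <-]]; rewrite setTI; apply: sub_sigma_algebra.
exact/fc/interval_open.
Qed.

Lemma mulg_borel_measurable (K : topGroupType) (h : K) :
  measurable_fun [set: borel K] ((fun k : K => (h * k)%g) : borel K -> borel K).
Proof.
apply: (@measurability _ _ (borel K) (borel K) setT _ (@open K) erefl).
move=> _ [V Vo <-]; rewrite setTI.
apply: sub_sigma_algebra.
have /continuousP : continuous (fun k : K => (h * k)%g); last exact.
move=> k; apply: (@continuous_comp _ _ _ (fun k : K => (h, k))
  (fun p : K * K => (p.1 * p.2)%g)).
  by apply: cvg_pair; [exact: cvg_cst|exact: cvg_id].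
exact: mulg_continuous.
Qed.

(** The invariance axiom of Haar measure moves sets; the change of variables
formula turns it into invariance of integrals.  The latter formula holds for
nonnegative functions without integrability, so it is applied to the positive
and the negative parts separately. *)
Lemma haar_integral_mulg (R : realType) (K : topGroupType)
    (mu : probability (borel K) R) (h : K) (f : K -> R) :
  is_haar mu -> continuous f ->
  \int[mu]_k f (h * k)%g = \int[mu]_k f k.
Proof.
move=> [mul_mu _ _] /continuous_borel_measurable mf.
have mh := mulg_borel_measurable h.
pose mh_mixin := isMeasurableFun.Build _ _ _ _ _ mh.
pose mh_pack : {mfun borel K >-> borel K} :=
  HB.pack (fun k : K => (h * k)%g : borel K) mh_mixin.
have mu_h : forall B, measurable B -> pushforward mu mh_pack B = mu B.
  (* The preimage of B under translation by h is its image under h^-1. *)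
  move=> B mB; rewrite -(mul_mu h^-1%g B mB) /pushforward; congr (mu _).
  apply/seteqP; split=> [k Bhk|_ [k Bk <-]].
    by exists (h * k)%g => //; rewrite mulKg.
  by rewrite /preimage /= mulVKg.
have ge0 (g : borel K -> \bar R) :
    measurable_fun setT g -> (forall k, 0 <= g k)%E ->
    (\int[mu]_k g (h * k)%g = \int[mu]_k g k)%E.
  move=> mg g0.
  transitivity (\int[pushforward mu mh_pack]_k g k)%E.
    by rewrite (ge0_integral_pushforward mh mu).
  by apply: eq_measure_integral => B mB _; exact: mu_h.
have mEf : measurable_fun [set: borel K] (fun k : borel K => (f k)%:E).
  exact/measurable_EFinP.
rewrite /Rintegral; congr fine.
rewrite integralE [RHS]integralE; congr (_ - _)%E.
  rewrite -(ge0 _ (measurable_funepos mEf)); last first.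
    by move=> k; exact: funepos_ge0.
  by apply: eq_integral => k _; rewrite !funeposE.
rewrite -(ge0 _ (measurable_funeneg mEf)); last first.
  by move=> k; exact: funeneg_ge0.
by apply: eq_integral => k _; rewrite !funenegE.
Qed.

Lemma haar_cintegral_mulg (R : realType) (K : topGroupType)
    (mu : probability (borel K) R) (h : K) (f : K -> cplx R) :
  is_haar mu -> continuous f ->
  cintegral mu (fun k => f (h * k)%g) = cintegral mu f.
Proof.
move=> haar_mu fc; rewrite /cintegral.
have Re_c : continuous (fun k : K => complex.Re (f k)).
  by move=> k; apply: (continuous_comp (fc k)); exact: continuous_Re.
have Im_c : continuous (fun k : K => complex.Im (f k)).
  have -> : (fun k : K => complex.Im (f k)) =
      (fun k : K => complex.Re (- 'i%C * f k)).
    by apply/funext => k; rewrite Im_eq_Re.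
  move=> k; apply: (@continuous_comp _ _ _ (fun k => - 'i%C * f k : cplx R));
    last exact: continuous_Re.
  by apply: cvgMl_tmp; exact: fc.
rewrite (haar_integral_mulg h haar_mu Re_c).
by rewrite (haar_integral_mulg h haar_mu Im_c).
Qed.

(** * Unitaries and their fixed vectors *)

(** [adjoint] is picked by a choice operator, so this property holds only once
some adjoint is exhibited; for a unitary, a right inverse is one. *)
Lemma unitary_adjointP (R : realType) (H : hilbertType R) (T : H -> H) :
  unitary_op T -> forall v w, inner (adjoint T v) w = inner v (T w).
Proof.
move=> [_ T_inner /choice[S ST]].
apply: (@xgetPex _ _ [set S | forall v w, inner (S v) w = inner v (T w)]).
by exists S => v w; rewrite -T_inner ST.
Qed.

Lemma inner_ext (R : realType) (H : hilbertType R) (v w : H) :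
  (forall u, inner v u = inner w u) -> v = w.
Proof.
move=> vw; apply/eqP; rewrite -subr_eq0 -(dnorm_eq0 (@inner R H)).
by rewrite linearBl /= vw subrr.
Qed.

Lemma adjoint_fixed (R : realType) (H : hilbertType R) (T : H -> H) (xi : H) :
  unitary_op T -> T xi = xi -> adjoint T xi = xi.
Proof.
move=> uT Txi; apply: inner_ext => u; rewrite (unitary_adjointP uT).
by case: uT => _ T_inner _; rewrite -{1}Txi T_inner.
Qed.

Lemma vector_state_conj_by (R : realType) (A : cstarAlgType R)
    (H : hilbertType R) (U : starAut A -> H -> H) (g : starAut A) (xi : H)
    (x : H -> H) :
  unitary_op (U g) -> U g xi = xi ->
  vector_state xi (conj_by U g x) = vector_state xi x.
Proof.
move=> uU Uxi; rewrite /vector_state /conj_by /= adjoint_fixed //.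
case: uU => _ U_inner _; congr (_ * _).
by rewrite -[RHS]U_inner Uxi.
Qed.

Lemma vector_state_is_operator_state (R : realType) (H : hilbertType R)
    (M : set (H -> H)) (xi : H) :
  xi != 0 -> is_operator_state M (vector_state xi).
Proof.
move=> xi0; split.
- move=> c S T _ _; rewrite /vector_state linearDl linearZl_LR /=.
  by rewrite mulrDr mulrCA.
- move=> T _ T_ge0; apply: mulr_ge0 (T_ge0 xi).
  by rewrite invr_ge0 exprn_ge0.
- by rewrite /vector_state -norm_inner mulVf // expf_neq0 // normr_eq0.
Qed.

(** Every [w] is of the form [V h w'], which moves [V h] from [P v] into the
integrand, where it meets [V k] and becomes [V (h * k)]. *)
Lemma operator_integral_fixed (R : realType) (H : hilbertType R)
    (K : topGroupType) (mu : probability (borel K) R)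
    (V : K -> H -> H) (P : H -> H) (h : K) (v : H) :
  is_haar mu -> is_operator_integral mu V P ->
  (forall w, continuous (fun k : K => V k w)) ->
  (forall k, V (h * k)%g v = V h (V k v)) -> unitary_op (V h) ->
  V h (P v) = P v.
Proof.
move=> haar_mu P_int V_cont V_mul [_ Vh_inner Vh_surj].
apply: inner_ext => w; have [w' <-] := Vh_surj w.
rewrite Vh_inner !P_int -[RHS](haar_cintegral_mulg h haar_mu); last first.
  move=> k; apply: (@continuous_comp _ _ _ (fun k => V k v)
    (fun u => inner u (V h w') : cplx R)); first exact: V_cont.
  exact: continuous_innerl.
by congr cintegral; apply/funext => k; rewrite V_mul Vh_inner.
Qed.

(** Both sides of [<xi, w'> = <xi, T w'>] are limits of the same scalar
sequence, because [<u N, w'> = <T (u N), T w'> = <u N, T w'>] eventually. *)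
Lemma unitary_limit_fixed (R : realType) (H : hilbertType R) (T : H -> H)
    (u : nat -> H) (xi : H) :
  unitary_op T -> u N @[N --> \oo] --> xi ->
  (\forall N \near \oo, T (u N) = u N) -> T xi = xi.
Proof.
move=> [_ T_inner T_surj] u_xi Tu.
apply: inner_ext => w; have [w' <-] := T_surj w; rewrite T_inner.
have L (z : H) :
    inner (u N) z @[N --> \oo] --> (inner xi z : cplx R).
  exact: (cvg_comp _ _ u_xi (@continuous_innerl R H z xi)).
have uniq_lim (z1 z2 : R[i]) := @norm_cvg_unique _ (cplx R)
  (inner (u N) w' @[N --> \oo]) _ z1 z2.
apply: uniq_lim; first exact: L.
apply: (cvg_trans _ (L (T w'))); apply: near_eq_cvg.
by apply: filterS Tu => N TuN; rewrite -[RHS]T_inner TuN.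
Qed.

(** * Invariance of the state *)

Theorem theorem3p2 (R : realType) (A : cstarAlgType R)
    (K : nat -> topGroupType)
    (K_compact : forall N, compact [set: K N])
    (K_hausdorff : forall N, hausdorff_space (K N))
    (alpha : forall N, {multiplicative K N -> starAut A})
    (alpha_inj : forall N, injective (alpha N))
    (alpha_incr : forall N, range (alpha N) `<=` range (alpha N.+1))
    (G : set (starAut A)) (G_def : G = \bigcup_N range (alpha N))
    (phi : A -> R[i]) (phi_state : is_state phi) (phi_faithful : is_faithful phi)
    (phi_sqi : strongly_quasi_invariant G phi)
    (H : hilbertType R) (pi : A -> H -> H) (Phi : H)
    (gns : is_gns phi pi Phi)
    (U : starAut A -> H -> H) (U_rep : is_unitary_rep G U)
    (U_formula : quasi_koopman phi pi Phi G U)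
    (rn_cont : forall N, continuous (fun k : K N => rn phi (alpha N k)))
    (U_cont : forall N v, continuous (fun k : K N => U (alpha N k) v))
    (mu : forall N, probability (borel (K N)) R)
    (mu_haar : forall N, is_haar (mu N))
    (P : nat -> H -> H)
    (P_def : forall N,
      is_operator_integral (mu N) (fun k : K N => U (alpha N k)) (P N))
    (PG : H -> H) (PG_def : forall v, P N v @[N --> \oo] --> PG v)
    (PhiG_neq0 : PG Phi != 0) :
  is_operator_state (bicommutant (range pi)) (vector_state (PG Phi)) /\
  forall (g : starAut A) (x : H -> H),
    G g -> bicommutant (range pi) x ->
    vector_state (PG Phi) (conj_by U g x) = vector_state (PG Phi) x.
Proof.
split; first exact: vector_state_is_operator_state.
move=> g x Gg _; have uU := rep_unitary U_rep Gg.
apply: vector_state_conj_by => //.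
apply: (unitary_limit_fixed uU (PG_def Phi)).
have [M _ gM] : (\bigcup_N range (alpha N)) g by rewrite -G_def.
exists M => // N /= MN.
have {gM}[h _ gE] : range (alpha N) g.
  rewrite -(subnK MN); elim: (N - M)%N => // n; rewrite addSn.
  exact: alpha_incr.
have GN (k : K N) : G (alpha N k) by rewrite G_def; exists N.
rewrite -gE; apply: (operator_integral_fixed (V := fun k => U (alpha N k))
  (mu_haar N) (P_def N)) => //.
- by move=> k; rewrite gmulfM (rep_mul U_rep).
- exact: (rep_unitary U_rep (GN h)).
Qed.
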